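(* Let $R$ be an fppf-local ring. For every prime ideal $\mathfrak{p}\subset R$, the local ring $R_{\mathfrak{p}}$ is strictly local, with algebraically closed residue field.
   Context: Rings are commutative with unit. A ring homomorphism $R\to B$ is fppf if it is faithfully flat and of finite presentation. A ring $R$ is called fppf-local if it is local and every fppf homomorphism $R\to B$ admits a retraction, i.e. an $R$-algebra homomorphism $B\to R$. A strictly local ring is a henselian local ring with separably closed residue field. *)

(* Defs.v *)
From HB Require Import structures.
From mathcomp Require Import finmap monalg mpoly.
From mathcomp Require Import all_boot all_algebra all_field.
From mathcomp Require Import generic_quotient ring_quotient sesquilinear ring.
From mathcomp Require Import boolp.

Set Implicit Arguments.
Unset Strict Implicit.
Unset Printing Implicit Defensive.

Import GRing.Theory.

Local Open Scope ring_scope.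
Local Open Scope quotient_scope.

(* All rings are [comNzRingType].  The zero ring is not local, and it is not
   faithfully flat over a nonzero ring, so it never occurs below. *)

(* Ideals are the (proper) ideals [idealr] of [ring_quotient].  These are boolean
   predicates; with the axioms of [boolp] every subset is of this form. *)

HB.mixin Record isMaxIdealr (A : nzRingType) (S : A -> bool) of Idealr A S := {
  max_idealr_subproof :
    forall J : idealr A, {subset S <= J} -> {subset J <= S}
}.

#[short(type="max_idealr")]
HB.structure Definition MaxIdealr (A : nzRingType) :=
  {S of Idealr A S & isMaxIdealr A S}.

Definition is_local (A : comNzRingType) : Prop :=
  exists m : max_idealr A, forall m' : max_idealr A, m' =i m.

Section Residue.
Variables (A : comNzRingType) (m : max_idealr A).

Definition residue : Type := {ideal_quot m}.
HB.instance Definition _ := GRing.ComNzRing.on residue.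

Definition to_residue (x : A) : residue := \pi_{ideal_quot m} x.

Lemma to_residue_zmod_morphism : zmod_morphism to_residue.
Proof. by move=> x y; rewrite /to_residue rmorphB. Qed.

Lemma to_residue_monoid_morphism : monoid_morphism to_residue.
Proof.
by split=> [|x y]; rewrite /to_residue ?rmorph1 ?rmorphM.
Qed.

HB.instance Definition _ :=
  GRing.isZmodMorphism.Build A residue to_residue to_residue_zmod_morphism.
HB.instance Definition _ :=
  GRing.isMonoidMorphism.Build A residue to_residue to_residue_monoid_morphism.

Lemma to_residue_surj (x : residue) : exists a, to_residue a = x.
Proof. by exists (repr x); rewrite /to_residue reprK. Qed.

Lemma to_residue_eq0 (a : A) : (to_residue a == 0) = (a \in m).
Proof.
have -> : 0 = \pi_{ideal_quot m} (0 : A) :> residue by rewrite rmorph0.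
by rewrite /to_residue -Quotient.idealrBE subr0.
Qed.

Definition adjoin (a : A) : {pred A} :=
  fun x => `[< exists b c, c \in m /\ x = b * a + c >].

Lemma residue_inv_ex (x : residue) : x != 0 -> exists y, y * x = 1.
Proof.
have [a <-] := to_residue_surj x; rewrite to_residue_eq0 => aNm.
have [/asboolP[b [c [cm e]]]|oneN] := boolP (1 \in adjoin a).
  exists (to_residue b); rewrite -rmorphM -[RHS](rmorph1 to_residue) e.
  move: cm; rewrite -to_residue_eq0 => /eqP c0.
  by rewrite [RHS]rmorphD /= c0 addr0.
have clo : idealr_closed (adjoin a).
  split=> // [|u v w /asboolP[b [c [cm ->]]] /asboolP[b' [c' [cm' ->]]]].
    by apply/asboolP; exists 0, 0; rewrite rpred0 mul0r addr0.
  apply/asboolP; exists (u * b + b'), (u * c + c'); split.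
    by rewrite rpredD // idealMr.
  by rewrite mulrDr mulrDl mulrA addrACA.
pose J : idealr A := HB.pack (adjoin a : A -> bool) (isIdealr.Build A _ clo).
have mJ : {subset m <= J}.
  by move=> c cm; apply/asboolP; exists 0, c; rewrite mul0r add0r.
have aJ : a \in J.
  by apply/asboolP; exists 1, 0; rewrite rpred0 mul1r addr0.
by case/negP: aNm; apply: max_idealr_subproof aJ.
Qed.

Definition residue_inv (x : residue) : residue :=
  if pselect (exists y, y * x == 1) is left h then xchoose h else x.

Definition residue_unit : pred residue := fun x => x != 0.

Lemma residue_mulVr : {in residue_unit, left_inverse 1 residue_inv *%R}.
Proof.
move=> x xN0; rewrite /residue_inv; case: pselect => [h|[]].
  exact/eqP/(xchooseP h).
by have [y yx] := residue_inv_ex xN0; exists y; apply/eqP.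
Qed.

Lemma residue_unitP (x y : residue) : y * x = 1 -> residue_unit x.
Proof.
by move=> yx; apply/eqP=> x0; move/eqP: yx; rewrite x0 mulr0 eq_sym oner_eq0.
Qed.

Lemma residue_invr_out : {in [predC residue_unit], residue_inv =1 id}.
Proof.
move=> x xN; rewrite /residue_inv; case: pselect => // h.
have [y /eqP yx] := h.
by case/negP: xN; apply: residue_unitP yx.
Qed.

HB.instance Definition _ := GRing.ComNzRing_hasMulInverse.Build residue
  residue_mulVr residue_unitP residue_invr_out.

Lemma residue_field_axiom : GRing.field_axiom residue.
Proof. by move=> x xN0. Qed.

HB.instance Definition _ :=
  GRing.ComUnitRing_isField.Build residue residue_field_axiom.

End Residue.

Section Localization.
Variables (R : comNzRingType) (p : prime_idealr R).

Record prefrac := PreFrac { pnum : R * R; _ : pnum.2 \notin p }.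

HB.instance Definition _ := [isSub for pnum].
HB.instance Definition _ := [Choice of prefrac by <:].

Lemma pdenP (x : prefrac) : (pnum x).2 \notin p. Proof. by case: x. Qed.

Lemma one_notin_prime : 1 \notin p. Proof. by rewrite idealr1. Qed.

Lemma mul_notin_prime (s t : R) : s \notin p -> t \notin p -> s * t \notin p.
Proof. by move=> sp tp; rewrite prime_idealrM negb_or sp. Qed.

(* The factor [t] is needed because [R] may have zero divisors. *)
Definition loc_eq : rel prefrac := fun x y =>
  `[< exists2 t, t \notin p &
      t * ((pnum x).1 * (pnum y).2) = t * ((pnum y).1 * (pnum x).2) >].

Lemma loc_eq_refl : reflexive loc_eq.
Proof. by move=> x; apply/asboolP; exists 1; rewrite ?one_notin_prime. Qed.

Lemma loc_eq_sym : symmetric loc_eq.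
Proof.
by move=> x y; apply/asboolP/asboolP=> -[t tp e]; exists t.
Qed.

Lemma loc_eq_trans : transitive loc_eq.
Proof.
move=> y x z /asboolP[t tp e] /asboolP[t' tp' e']; apply/asboolP.
exists (t * t' * (pnum y).2); first by rewrite !mul_notin_prime ?pdenP.
case: x y z e e' => [[a s] /= _] [[b u] /= _] [[c v] /= _] e e'.
transitivity (t' * v * (t * (a * u))); first by ring.
rewrite e; transitivity (t * s * (t' * (b * v))); first by ring.
by rewrite e'; ring.
Qed.

Canonical loc_equiv := EquivRel loc_eq loc_eq_refl loc_eq_sym loc_eq_trans.

Definition loc : Type := {eq_quot loc_eq}.
HB.instance Definition _ : EqQuotient _ loc_eq loc :=
  EqQuotient.on loc.
HB.instance Definition _ := Choice.on loc.

Definition loc_zero := \pi_loc (PreFrac (pnum := (0, 1)) one_notin_prime).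
Definition loc_one := \pi_loc (PreFrac (pnum := (1, 1)) one_notin_prime).

Definition preadd (x y : prefrac) : prefrac :=
  PreFrac (pnum := ((pnum x).1 * (pnum y).2 + (pnum y).1 * (pnum x).2,
                    (pnum x).2 * (pnum y).2))
    (mul_notin_prime (pdenP x) (pdenP y)).
Definition preopp (x : prefrac) : prefrac :=
  PreFrac (pnum := (- (pnum x).1, (pnum x).2)) (pdenP x).
Definition premul (x y : prefrac) : prefrac :=
  PreFrac (pnum := ((pnum x).1 * (pnum y).1, (pnum x).2 * (pnum y).2))
    (mul_notin_prime (pdenP x) (pdenP y)).

Definition loc_add (x y : loc) : loc := \pi_loc (preadd (repr x) (repr y)).
Definition loc_opp (x : loc) : loc := \pi_loc (preopp (repr x)).
Definition loc_mul (x y : loc) : loc := \pi_loc (premul (repr x) (repr y)).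

Lemma loc_piE (x y : prefrac) : reflect
  (exists2 t, t \notin p &
     t * ((pnum x).1 * (pnum y).2) = t * ((pnum y).1 * (pnum x).2))
  (\pi_loc x == \pi_loc y).
Proof. by rewrite eqmodE; apply: asboolP. Qed.

Lemma loc_reprP (x : prefrac) : exists2 t, t \notin p &
  t * ((pnum (repr (\pi_loc x))).1 * (pnum x).2)
  = t * ((pnum x).1 * (pnum (repr (\pi_loc x))).2).
Proof. by apply/loc_piE; rewrite reprK. Qed.

Lemma pi_loc_add (x y : prefrac) :
  loc_add (\pi x) (\pi y) = \pi_loc (preadd x y).
Proof.
apply/eqP/loc_piE; have [t tp e] := loc_reprP x; have [u up f] := loc_reprP y.
exists (t * u); first exact: mul_notin_prime.
move: (repr _) e (repr _) f => [[a' s'] /= _] e [[b' v'] /= _] f.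
case: x y e f => [[a s] /= _] [[b v] /= _] e f.
transitivity (u * v * v' * (t * (a' * s)) + t * s * s' * (u * (b' * v))).
  by ring.
by rewrite e f; ring.
Qed.

Lemma pi_loc_opp (x : prefrac) : loc_opp (\pi x) = \pi_loc (preopp x).
Proof.
apply/eqP/loc_piE; have [t tp e] := loc_reprP x; exists t => //=.
by rewrite !mulNr !mulrN e.
Qed.

Lemma pi_loc_mul (x y : prefrac) :
  loc_mul (\pi x) (\pi y) = \pi_loc (premul x y).
Proof.
apply/eqP/loc_piE; have [t tp e] := loc_reprP x; have [u up f] := loc_reprP y.
exists (t * u); first exact: mul_notin_prime.
move: (repr _) e (repr _) f => [[a' s'] /= _] e [[b' v'] /= _] f.
case: x y e f => [[a s] /= _] [[b v] /= _] e f.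
transitivity ((t * (a' * s)) * (u * (b' * v))); first by ring.
by rewrite e f; ring.
Qed.

Let eq_loc (x y : prefrac) :
  (pnum x).1 * (pnum y).2 = (pnum y).1 * (pnum x).2 -> \pi_loc x = \pi_loc y.
Proof.
by move=> e; apply/eqP/loc_piE; exists 1; rewrite ?one_notin_prime ?e.
Qed.

Lemma loc_addA : associative loc_add.
Proof.
elim/quotW=> x; elim/quotW=> y; elim/quotW=> z; rewrite !pi_loc_add.
by apply: eq_loc => /=; ring.
Qed.

Lemma loc_addC : commutative loc_add.
Proof.
elim/quotW=> x; elim/quotW=> y; rewrite !pi_loc_add.
by apply: eq_loc => /=; rewrite addrC [_.2 * _.2]mulrC.
Qed.

Lemma loc_add0 : left_id loc_zero loc_add.
Proof.
elim/quotW=> x; rewrite pi_loc_add; apply: eq_loc => /=.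
by rewrite mul0r add0r mulr1 mul1r.
Qed.

Lemma loc_addN : left_inverse loc_zero loc_opp loc_add.
Proof.
elim/quotW=> x; rewrite pi_loc_opp pi_loc_add; apply: eq_loc => /=.
by rewrite mulNr addNr !mul0r.
Qed.

HB.instance Definition _ :=
  GRing.isZmodule.Build loc loc_addA loc_addC loc_add0 loc_addN.

Lemma loc_mulA : associative loc_mul.
Proof.
elim/quotW=> x; elim/quotW=> y; elim/quotW=> z; rewrite !pi_loc_mul.
by apply: eq_loc => /=; rewrite !mulrA.
Qed.

Lemma loc_mulC : commutative loc_mul.
Proof.
elim/quotW=> x; elim/quotW=> y; rewrite !pi_loc_mul.
by apply: eq_loc => /=; rewrite [_.1 * _.1]mulrC [_.2 * _.2]mulrC.
Qed.

Lemma loc_mul1 : left_id loc_one loc_mul.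
Proof.
by elim/quotW=> x; rewrite pi_loc_mul; apply: eq_loc => /=; rewrite !mul1r.
Qed.

Lemma loc_mulDl : left_distributive loc_mul loc_add.
Proof.
elim/quotW=> x; elim/quotW=> y; elim/quotW=> z.
by rewrite !(pi_loc_mul, pi_loc_add); apply: eq_loc => /=; ring.
Qed.

Lemma loc_1_neq0 : loc_one != loc_zero.
Proof.
apply/loc_piE => -[t tp /=]; rewrite mul0r !mulr1 mulr0 => t0.
by move: tp; rewrite t0 rpred0.
Qed.

HB.instance Definition _ := GRing.Zmodule_isComNzRing.Build loc
  loc_mulA loc_mulC loc_mul1 loc_mulDl loc_1_neq0.

Definition to_loc (x : R) : loc :=
  \pi_loc (PreFrac (pnum := (x, 1)) one_notin_prime).

Lemma to_loc_zmod_morphism : zmod_morphism to_loc.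
Proof.
move=> x y; rewrite /to_loc -[RHS]/(loc_add _ (loc_opp _)).
by rewrite pi_loc_opp pi_loc_add; apply: eq_loc => /=; ring.
Qed.

Lemma to_loc_monoid_morphism : monoid_morphism to_loc.
Proof.
by split=> // x y; rewrite [RHS]pi_loc_mul; apply: eq_loc => /=; ring.
Qed.

HB.instance Definition _ :=
  GRing.isZmodMorphism.Build R loc to_loc to_loc_zmod_morphism.
HB.instance Definition _ :=
  GRing.isMonoidMorphism.Build R loc to_loc to_loc_monoid_morphism.

End Localization.

Section SpanQuotient.
Variables (R : nzRingType) (V : lmodType R) (S : V -> Prop).

Inductive span : V -> Prop :=
| span0 : span 0
| spanZD a u v : S u -> span v -> span (a *: u + v).

Lemma spanD u v : span u -> span v -> span (u + v).
Proof.
elim=> [|a w w' Sw _ IH] sv; first by rewrite add0r.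
by rewrite -addrA; apply: spanZD (IH sv).
Qed.

Lemma spanZ a u : span u -> span (a *: u).
Proof.
elim=> [|b w w' Sw _ IH]; first by rewrite scaler0; apply: span0.
by rewrite scalerDr scalerA; apply: spanZD.
Qed.

Lemma span_gen u : S u -> span u.
Proof.
by move=> Su; rewrite -[u]scale1r -[_ *: _]addr0; apply: spanZD span0.
Qed.

Definition spanb : V -> bool := fun v => `[< span v >].

Lemma spanb_zmod_closed : zmod_closed (spanb : {pred V}).
Proof.
split=> [|u v /asboolP su /asboolP sv]; first exact/asboolP/span0.
by apply/asboolP/spanD => //; rewrite -scaleN1r; apply: spanZ.
Qed.

Definition span_closed : zmodClosed V :=
  HB.pack (spanb : V -> bool) (GRing.isZmodClosed.Build V spanb spanb_zmod_closed).

(* The quotient of [V] by the submodule spanned by [S]. *)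
Definition lquot : Type := (Quotient.quot span_closed).
HB.instance Definition _ := GRing.Zmodule.on lquot.

Definition to_lquot (v : V) : lquot := \pi_(Quotient.quot span_closed) v.

Lemma to_lquot_eq u v : to_lquot u = to_lquot v <-> span (u - v).
Proof.
rewrite /to_lquot; split=> [/eqP|s].
  by rewrite -Quotient.idealrBE => /asboolP.
by apply/eqP; rewrite -Quotient.idealrBE; apply/asboolP.
Qed.

Lemma to_lquot_zmod_morphism : zmod_morphism to_lquot.
Proof. by move=> u v; rewrite /to_lquot raddfB. Qed.

HB.instance Definition _ :=
  GRing.isZmodMorphism.Build V lquot to_lquot to_lquot_zmod_morphism.

Lemma lquotW (P : lquot -> Prop) : (forall v, P (to_lquot v)) -> forall x, P x.
Proof. by move=> PV x; rewrite -[x]reprK; apply: PV. Qed.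

Lemma span_repr v : span (repr (to_lquot v) - v).
Proof. by apply/to_lquot_eq; rewrite [LHS]reprK. Qed.

Definition lquot_scale (a : R) (x : lquot) : lquot := to_lquot (a *: repr x).

Lemma lquot_scaleE a v : lquot_scale a (to_lquot v) = to_lquot (a *: v).
Proof. by apply/to_lquot_eq; rewrite -scalerBr; apply/spanZ/span_repr. Qed.

Lemma lquot_scaleA a b x :
  lquot_scale a (lquot_scale b x) = lquot_scale (a * b) x.
Proof. by elim/lquotW: x => v; rewrite !lquot_scaleE scalerA. Qed.

Lemma lquot_scale1 : left_id 1 lquot_scale.
Proof. by elim/lquotW=> v; rewrite lquot_scaleE scale1r. Qed.

Lemma lquot_scaleDr : right_distributive lquot_scale +%R.
Proof.
move=> a; elim/lquotW=> u; elim/lquotW=> v.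
by rewrite -raddfD !lquot_scaleE -raddfD scalerDr.
Qed.

Lemma lquot_scaleDl x : {morph lquot_scale^~ x : a b / a + b}.
Proof.
by elim/lquotW: x => v a b; rewrite !lquot_scaleE scalerDl raddfD.
Qed.

HB.instance Definition _ := GRing.Zmodule_isLmodule.Build R lquot
  lquot_scaleA lquot_scale1 lquot_scaleDr lquot_scaleDl.

Lemma to_lquot_scalable : scalable to_lquot.
Proof. by move=> a v; rewrite -lquot_scaleE. Qed.

HB.instance Definition _ :=
  GRing.isScalable.Build R V lquot *:%R to_lquot to_lquot_scalable.

End SpanQuotient.

(* [{malg R[K]}] is used as the free [R]-module on the set [K]. *)

Section FreeLift.
Variables (R : comNzRingType) (K : choiceType) (V : lmodType R) (f : K -> V).

Definition free_gen (k : K) : {malg R[K]} := mkmalgU k 1.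

Definition free_lift (g : {malg R[K]}) : V :=
  \sum_(k <- monalg.msupp g) monalg.mcoeff k g *: f k.

Lemma free_liftEw (g : {malg R[K]}) (d : {fset K}) :
  (monalg.msupp g `<=` d)%fset ->
  free_lift g = \sum_(k <- d) monalg.mcoeff k g *: f k.
Proof.
move=> gd; rewrite /free_lift (big_fset_incl _ gd) // => k _.
by rewrite -monalg.mcoeff_eq0 => /eqP ->; rewrite scale0r.
Qed.

Lemma free_lift_is_linear : linear free_lift.
Proof.
move=> a g h; pose d := (monalg.msupp g `|` monalg.msupp h)%fset.
rewrite (@free_liftEw g d) ?fsubsetUl // (@free_liftEw h d) ?fsubsetUr //.
rewrite (@free_liftEw (a *: g + h) d); last first.
  apply: fsubset_trans (monalg.msuppD_le _ _) _.
  by apply: fsetSU; apply: monalg.msuppZ_le.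
rewrite scaler_sumr -big_split; apply: eq_bigr => k _.
by rewrite monalg.mcoeffD monalg.mcoeffZ scalerDl scalerA.
Qed.

HB.instance Definition _ := GRing.isLinear.Build R _ V *:%R
  free_lift free_lift_is_linear.

Lemma free_lift_gen (k : K) : free_lift (free_gen k) = f k.
Proof.
rewrite (@free_liftEw _ [fset k]%fset) ?monalg.msuppU_le //.
by rewrite big_seq_fset1 monalg.mcoeffUU scale1r.
Qed.

End FreeLift.

Section Tensor.
Variables (R : comNzRingType) (M N : lmodType R).

Local Notation gen m n := (free_gen R ((m, n) : M * N)).

Inductive tensor_rel : {malg R[(M * N)%type]} -> Prop :=
| tensor_rel_Dl m m' n : tensor_rel (gen (m + m') n - gen m n - gen m' n)
| tensor_rel_Dr m n n' : tensor_rel (gen m (n + n') - gen m n - gen m n')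
| tensor_rel_Zl a m n : tensor_rel (gen (a *: m) n - a *: gen m n)
| tensor_rel_Zr a m n : tensor_rel (gen m (a *: n) - a *: gen m n).

Definition tensor : Type := lquot tensor_rel.
HB.instance Definition _ := GRing.Lmodule.on tensor.

Definition pure (m : M) (n : N) : tensor := to_lquot tensor_rel (gen m n).

Lemma pure_bilinear : bilinear_for *:%R *:%R pure.
Proof.
have e u v : tensor_rel (u - v) -> to_lquot tensor_rel u = to_lquot _ v.
  by move=> r; apply/to_lquot_eq/span_gen.
have pDl m m' n : pure (m + m') n = pure m n + pure m' n.
  by rewrite -raddfD; apply: e; rewrite opprD addrA; apply: tensor_rel_Dl.
have pDr m n n' : pure m (n + n') = pure m n + pure m n'.
  by rewrite -raddfD; apply: e; rewrite opprD addrA; apply: tensor_rel_Dr.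
have pZl a m n : pure (a *: m) n = a *: pure m n.
  by rewrite -linearZ; apply: e; apply: tensor_rel_Zl.
have pZr a m n : pure m (a *: n) = a *: pure m n.
  by rewrite -linearZ; apply: e; apply: tensor_rel_Zr.
by split=> [n a m m'|m a n n']; rewrite /= ?(pDl, pDr) ?(pZl, pZr).
Qed.

HB.instance Definition _ :=
  bilinear_isBilinear.Build R M N tensor *:%R *:%R pure pure_bilinear.

Section Lift.
Variables (P : lmodType R) (b : {bilinear M -> N -> P}).

Local Notation lift := (free_lift (fun mn : M * N => b mn.1 mn.2)).

Definition tensor_lift (x : tensor) : P := lift (repr x).

Lemma tensor_lift_span u : span tensor_rel u -> lift u = 0.
Proof.
have fB v w : lift (v - w) = lift v - lift w by rewrite linearB.
have fZ a v : lift (a *: v) = a *: lift v by rewrite linearZ.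
elim=> [|a v w r _ IH]; first exact: linear0.
rewrite linearP /= IH addr0; case: r => [m m' n|m n n'|c m n|c m n].
- by rewrite !fB !free_lift_gen /= linearDl addrAC addrK subrr scaler0.
- by rewrite !fB !free_lift_gen /= linearDr addrAC addrK subrr scaler0.
- by rewrite !fB !fZ !free_lift_gen /= linearZl_LR subrr scaler0.
- by rewrite !fB !fZ !free_lift_gen /= linearZr_LR subrr scaler0.
Qed.

Lemma tensor_lift_pi u : tensor_lift (to_lquot tensor_rel u) = lift u.
Proof.
apply/eqP; rewrite -subr_eq0 -linearB; apply/eqP/tensor_lift_span.
exact: span_repr.
Qed.

Lemma tensor_lift_is_linear : linear tensor_lift.
Proof.
move=> a; elim/lquotW=> u; elim/lquotW=> v.
by rewrite -linearP !tensor_lift_pi linearP.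
Qed.

HB.instance Definition _ := GRing.isLinear.Build R tensor P *:%R
  tensor_lift tensor_lift_is_linear.

Lemma tensor_lift_pure m n : tensor_lift (pure m n) = b m n.
Proof. by rewrite tensor_lift_pi free_lift_gen. Qed.

End Lift.

Lemma tensor_ext (P : lmodType R) (f g : {linear tensor -> P}) :
  (forall m n, f (pure m n) = g (pure m n)) -> f =1 g.
Proof.
move=> fg; elim/lquotW=> u; rewrite [u]monalg.monalgE raddf_sum !linear_sum /=.
apply: eq_bigr => -[m n] _.
have -> : (<< monalg.mcoeff (m, n) u *g (m, n) >> : {malg R[(M * N)%type]})
       = monalg.mcoeff (m, n) u *: gen m n.
  apply/monalg.malgP => k.
  by rewrite monalg.mcoeffZ !monalg.mcoeffU mulrnAr mulr1.
by rewrite !linearZ /= fg.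
Qed.

End Tensor.

Section TensorMap.
Variables (R : comNzRingType) (M N N' : lmodType R) (f : {linear N -> N'}).

Definition tensor_map_bil (m : M) (n : N) : tensor M N' := pure m (f n).

Lemma tensor_map_bilinear : bilinear_for *:%R *:%R tensor_map_bil.
Proof.
split=> [n a m m'|m a n n'] /=; rewrite /tensor_map_bil.
  by rewrite linearPl.
by rewrite linearP linearPr.
Qed.

HB.instance Definition _ := bilinear_isBilinear.Build R M N (tensor M N')
  *:%R *:%R tensor_map_bil tensor_map_bilinear.

(* The map M (x) N -> M (x) N' sending m (x) n to m (x) f n. *)
Definition tensor_map : {linear tensor M N -> tensor M N'} :=
  tensor_lift tensor_map_bil.

End TensorMap.

Section Flatness.
Variable R : comNzRingType.

Definition is_exact (N1 N2 N3 : lmodType R) (f : N1 -> N2) (g : N2 -> N3) : Prop :=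
  forall y, g y = 0 <-> exists x, f x = y.

Definition faithfully_flat (M : lmodType R) : Prop :=
  forall (N1 N2 N3 : lmodType R) (f : {linear N1 -> N2}) (g : {linear N2 -> N3}),
    (forall x, g (f x) = 0) ->
    is_exact f g <-> is_exact (tensor_map M f) (tensor_map M g).

End Flatness.

(* [B] as an [R]-module through [phi]. *)
Definition via_hom (R B : comNzRingType) (phi : {rmorphism R -> B}) : Type := B.

Section RingHom.
Variables (R B : comNzRingType) (phi : {rmorphism R -> B}).
Local Notation B_phi := (via_hom phi).

HB.instance Definition _ := GRing.Zmodule.copy B_phi B.

Definition via_scale (a : R) (x : B_phi) : B_phi := phi a * (x : B).

Lemma via_scaleA a b x : via_scale a (via_scale b x) = via_scale (a * b) x.
Proof. by rewrite /via_scale rmorphM mulrA. Qed.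

Lemma via_scale1 : left_id 1 via_scale.
Proof. by move=> x; rewrite /via_scale rmorph1 mul1r. Qed.

Lemma via_scaleDr : right_distributive via_scale +%R.
Proof. by move=> a x y; rewrite /via_scale mulrDr. Qed.

Lemma via_scaleDl x : {morph via_scale^~ x : a b / a + b}.
Proof. by move=> a b; rewrite /via_scale rmorphD mulrDl. Qed.

HB.instance Definition _ := GRing.Zmodule_isLmodule.Build R B_phi
  via_scaleA via_scale1 via_scaleDr via_scaleDl.

(* [mpoly n R] is the polynomial ring of [mpoly]; its notation is shadowed here
   by that of [monalg]. *)
Definition finitely_presented : Prop :=
  exists (n : nat) (h : {rmorphism mpoly n R -> B}) (k : nat)
         (g : 'I_k -> mpoly n R),
    [/\ forall a, h a%:MP_[n] = phi a,
        forall b, exists q, h q = b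
      & forall q, h q = 0 <-> exists c : 'I_k -> mpoly n R,
          q = \sum_(i < k) c i * g i].

Definition fppf : Prop := faithfully_flat B_phi /\ finitely_presented.

End RingHom.

Definition fppf_local (R : comNzRingType) : Prop :=
  is_local R /\
  forall (B : comNzRingType) (phi : {rmorphism R -> B}), fppf phi ->
    exists r : {rmorphism B -> R}, forall a, r (phi a) = a.

Definition separably_closed (K : fieldType) : Prop :=
  forall f : {poly K}, separable_poly f -> (1 < size f)%N -> exists x, root f x.

(* A local ring is henselian if every simple root over the residue field of a
   monic polynomial lifts to a root. *)
Definition henselian (A : comNzRingType) : Prop :=
  is_local A /\
  forall (m : max_idealr A) (f : {poly A}) (x : residue m),
    f \is monic -> root (map_poly (to_residue m) f) x ->
    ~~ root (map_poly (to_residue m) f)^`() x ->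
    exists a, root f a /\ to_residue m a = x.

Definition strictly_local (A : comNzRingType) : Prop :=
  henselian A /\ forall m : max_idealr A, separably_closed (residue m).

(* Main.v *)
Require Import Defs.
From HB Require Import structures.
From mathcomp Require Import mpoly.
From mathcomp Require Import all_boot all_algebra all_field ring_quotient.
From mathcomp Require Import generic_quotient sesquilinear boolp ring.

Set Implicit Arguments.
Unset Strict Implicit.
Unset Printing Implicit Defensive.

Import GRing.Theory.
Import Pdiv.CommonRing Pdiv.RingMonic.

Local Open Scope ring_scope.
Local Open Scope quotient_scope.

(** For every nonconstant monic f over R, the homomorphism R -> R[X]/(f) is fppf
    ([qpoly_fppf]), so it has a retraction, which sends the class of X to a root
    of f in R.  Hence R is absolutely integrally closed: every
    nonconstant monic polynomial over R has a root ([fppf_local_aic]).  The rest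
    is formal.

    The property passes to any localization R_p ([aic_loc]): if s is a common
    denominator of the coefficients of f, of degree n, then s^n f(Y/s) is monic
    with coefficients in R, and a root c of it gives the root c/s of f.  It also
    passes to residue fields, because a monic polynomial over the residue field
    lifts to a monic polynomial; so the residue field of R_p is algebraically
    closed ([aic_residue_closed]), and a fortiori separably closed.  Finally,
    splitting off one root after the other writes a monic f over R_p as a
    product of factors X - a ([aic_split]), so the roots of f in the residue
    field are exactly the residues of the elements a.  All of them lift, simple or not, and the local
    ring R_p is henselian ([aic_henselian]).

    That R[X]/(f) is faithfully flat comes from its basis 1, X, .., X^(n-1) over
    R: tensoring with a free module on a nonempty finite basis I turns a
    sequence into a direct sum of copies of it indexed by I, and this preserves
    and reflects exactness ([faithfully_flat_basis]). *)

(** * Faithful flatness of free modules *)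

Section Flat.
Variables (R : comNzRingType) (M : lmodType R) (I : finType) (i0 : I).
Variables (c : I -> {linear M -> R^o}) (e : I -> M).
Hypothesis ce : forall i j, c i (e j) = (i == j)%:R.
Hypothesis Me : forall m, m = \sum_i c i m *: e i.

Section Coordinates.
Variables (N : lmodType R) (i : I).

Definition tcoord_bil (m : M) (x : N) : N := (c i m : R) *: x.

Lemma tcoord_bilinear : bilinear_for *:%R *:%R tcoord_bil.
Proof.
split=> [x a m m'|m a x x'] /=; rewrite /tcoord_bil.
  by rewrite linearP /= scalerDl scalerA.
by rewrite scalerDr !scalerA mulrC.
Qed.

HB.instance Definition _ := bilinear_isBilinear.Build R M N N
  *:%R *:%R tcoord_bil tcoord_bilinear.

(** The coordinate of index [i] of a tensor, under the identification of the
    tensor product of M and N with the functions from I to N. *)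
Definition tcoord : {linear tensor M N -> N} := tensor_lift tcoord_bil.

Lemma tcoord_pure m x : tcoord (pure m x) = (c i m : R) *: x.
Proof. exact: tensor_lift_pure. Qed.

End Coordinates.

Lemma tcoord_pure_basis (N : lmodType R) i (x : N) :
  tcoord N i (pure (e i) x) = x.
Proof. by rewrite tcoord_pure ce eqxx scale1r. Qed.

Lemma tensor_map_pure (N N' : lmodType R) (f : {linear N -> N'}) (m : M) x :
  tensor_map M f (pure m x) = pure m (f x).
Proof. exact: tensor_lift_pure. Qed.

Lemma tcoord_natural (N N' : lmodType R) (f : {linear N -> N'}) i t :
  tcoord N' i (tensor_map M f t) = f (tcoord N i t).
Proof.
pose g1 : {linear tensor M N -> N'} := tcoord N' i \o tensor_map M f.
pose g2 : {linear tensor M N -> N'} := f \o tcoord N i.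
apply: (@tensor_ext _ _ _ _ g1 g2) => m x.
by rewrite /= tensor_map_pure !tcoord_pure linearZ.
Qed.

Lemma tensor_basisE (N : lmodType R) (t : tensor M N) :
  t = \sum_i pure (e i) (tcoord N i t).
Proof.
have expand_linear : linear (fun t => \sum_i pure (e i) (tcoord N i t)).
  move=> a u v; rewrite scaler_sumr -big_split; apply: eq_bigr => i _ /=.
  by rewrite linearP linearPr.
pose expand : {linear tensor M N -> tensor M N} := HB.pack
  (fun t => \sum_i pure (e i) (tcoord N i t))
  (GRing.isLinear.Build R _ _ *:%R _ expand_linear).
apply: (@tensor_ext _ _ _ _ idfun expand) => m x /=.
rewrite [in LHS](Me m) linear_sumlz; apply: eq_bigr => i _.
by rewrite tcoord_pure linearZl_LR linearZr_LR.
Qed.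

(** Exactness of the tensored sequence can be tested on coordinates, by
    [tcoord_natural] and [tensor_basisE].  Nonemptiness of the basis, witnessed
    by [i0], is what makes exactness descend: a cycle y is seen inside the
    tensor product as e_i0 (x) y. *)
Lemma faithfully_flat_basis : faithfully_flat M.
Proof.
move=> N1 N2 N3 f g gf0; split=> ex y; split.
- move=> gy0.
  have /choice[x fx] i : exists x, f x = tcoord N2 i y.
    by apply/ex; rewrite -tcoord_natural gy0 linear0.
  exists (\sum_i pure (e i) (x i)); rewrite linear_sum [RHS]tensor_basisE.
  by apply: eq_bigr => i _; rewrite tensor_map_pure fx.
- case=> x <-; rewrite [LHS]tensor_basisE big1 // => i _.
  by rewrite !tcoord_natural gf0 linear0r.
- move=> gy0; have [|t ft] := (ex (pure (e i0) y)).1.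
    by rewrite tensor_map_pure gy0 linear0r.
  by exists (tcoord N1 i0 t); rewrite -tcoord_natural ft tcoord_pure_basis.
- by case=> x <-.
Qed.

End Flat.

(** * Monic quotients of the polynomial ring are fppf *)

Section MonicQuotient.
Variables (R : comNzRingType) (f : {poly R}).
Hypotheses (f_monic : f \is monic) (f_gt1 : (1 < size f)%N).

Let phi : {rmorphism R -> {poly %/ f}} := qpolyC f.
Let n := (size f).-1.

Let mk_f : mk_monic f = f.
Proof. by rewrite /mk_monic f_gt1 f_monic. Qed.

(** Scaling by a in [via_hom phi] is a product in the quotient ring, hence a
    remainder modulo f; linearity of this representative of degree less than n
    says that the product with a needs no reduction. *)
Definition qpoly_rep (b : via_hom phi) : {poly R} := val (b : {poly %/ f}).

Lemma qpoly_rep_linear : linear qpoly_rep.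
Proof.
move=> a b b'.
rewrite -[LHS]/(rmodp (a%:P * qpoly_rep b) (mk_monic f) + qpoly_rep b').
rewrite mul_polyC rmodpZ ?monic_mk_monic //.
by rewrite rmodp_small // size_mk_monic.
Qed.

HB.instance Definition _ := GRing.isLinear.Build R (via_hom phi) {poly R} *:%R
  qpoly_rep qpoly_rep_linear.

Lemma size_qpoly_rep (b : via_hom phi) : (size (qpoly_rep b) <= n)%N.
Proof. by apply: leq_trans (size_npoly (b : {poly %/ f})) _; rewrite mk_f. Qed.

Lemma qpoly_faithfully_flat : faithfully_flat (via_hom phi).
Proof.
have f_gt0 := ltnW f_gt1; have n_gt0 : (0 < n)%N by rewrite -ltnS prednK.
pose e (i : 'I_n) : via_hom phi := in_qpoly f 'X^i.
have eE i : qpoly_rep (e i) = 'X^i.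
  by apply: in_qpoly_small; rewrite mk_f size_polyXn -(prednK f_gt0) ltnS.
pose c (i : 'I_n) (b : via_hom phi) : R^o := (qpoly_rep b)`_i.
have c_lin i : linear (c i).
  by move=> a u v; rewrite /c linearP coefD coefZ.
pose cl i : {linear via_hom phi -> R^o} :=
  HB.pack (c i) (GRing.isLinear.Build R _ _ *:%R _ (c_lin i)).
apply: (@faithfully_flat_basis _ _ _ (Ordinal n_gt0) cl e) => [i j|b].
  by rewrite /= /c eE coefXn.
apply: (@val_inj _ _ {poly %/ f}); rewrite -[LHS]/(qpoly_rep b).
rewrite -[RHS]/(qpoly_rep _) linear_sum.
under eq_bigr => i _ do rewrite linearZ_LR /= eE.
rewrite -(poly_def n (fun i => (qpoly_rep b)`_i)).
apply/polyP=> k; rewrite coef_poly; case: ltnP => // nk.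
by rewrite nth_default // (leq_trans (size_qpoly_rep b)).
Qed.

Lemma qpoly_finitely_presented : finitely_presented phi.
Proof.
(* [u] and [v] identify R[X] with the polynomials in a single variable of
   [mpoly]; through them, [h] is the projection of R[X] to its quotient. *)
pose h : {rmorphism mpoly 1 R -> {poly %/ f}} := mmap phi (fun=> 'qX).
pose v : {rmorphism mpoly 1 R -> {poly R}} := mmap polyC (fun=> 'X).
pose u (p : {poly R}) : mpoly 1 R := (map_poly (@mpolyC 1 R) p).['X_ord0].
have uM p q : u (p * q) = u p * u q by rewrite /u rmorphM hornerM.
have uD p q : u (p + q) = u p + u q by rewrite /u rmorphD hornerD.
have uC c : u c%:P = c%:MP_[1] by rewrite /u map_polyC hornerC.
have uX : u 'X = 'X_ord0 by rewrite /u map_polyX hornerX.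
have u_exp p k : u (p ^+ k) = u p ^+ k by rewrite /u rmorphXn horner_exp.
have mX m : 'X_[m] = 'X_ord0 ^+ m ord0 :> mpoly 1 R.
  by rewrite [LHS]mpolyXE_id big_ord_recl big_ord0 mulr1.
have vC c : v c%:MP_[1] = c%:P by exact: mmapC.
have vX : v 'X_ord0 = 'X.
  by rewrite /v /= mmapX /mmap1 big_ord_recl big_ord0 mulr1 mnm1E eqxx expr1.
have uv q : u (v q) = q.
  elim/mpolyind: q => [|c m q _ _ IH].
    by rewrite rmorph0 -polyC0 uC mpolyC0.
  rewrite rmorphD uD IH -mul_mpolyC rmorphM uM vC uC.
  by rewrite mX rmorphXn u_exp vX uX.
have vu p : v (u p) = p.
  elim/poly_ind: p => [|p c IH]; first by rewrite -polyC0 uC vC.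
  by rewrite uD uM uX uC rmorphD rmorphM /= vX vC IH.
have hE q : h q = in_qpoly f (v q).
  elim/mpolyind: q => [|c m q _ _ IH]; first by rewrite !rmorph0.
  rewrite !rmorphD IH -mul_mpolyC !rmorphM mX !rmorphXn /= vX vC mmapC.
  rewrite mmapX /mmap1 big_ord_recl big_ord0 mulr1 mnm1E eqxx expr1.
  congr (_ * _ + _); apply/val_inj/esym/in_qpoly_small.
  by rewrite (leq_ltn_trans (size_polyC_leq1 _)) // mk_f.
have proj0 p : in_qpoly f p = 0 <-> exists c, p = c * f.
  split=> [/(congr1 val) /= | [c ->]].
    rewrite mk_f => p0; exists (rdivp p f).
    by rewrite {1}(rdivp_eq f_monic p) p0 addr0.
  by apply: val_inj; rewrite /= mk_f rmodp_mull.
exists 1%N, h, 1%N, (fun=> u f); split=> [a|b|q].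
- exact: mmapC.
- exists (u (val b)); rewrite hE vu; apply/val_inj/in_qpoly_small.
  exact: size_mk_monic.
- rewrite hE proj0; split=> [[c vq]|[c ->]].
    by exists (fun=> u c); rewrite big_ord1 -uM -vq uv.
  by exists (v (c ord0)); rewrite big_ord1 rmorphM /= vu.
Qed.

Lemma qpoly_fppf : fppf phi.
Proof.
split; [exact: qpoly_faithfully_flat | exact: qpoly_finitely_presented].
Qed.

End MonicQuotient.

(** * Absolutely integrally closed rings *)

Definition absolutely_integrally_closed (A : nzRingType) : Prop :=
  forall f : {poly A}, f \is monic -> (1 < size f)%N -> exists a, root f a.

Lemma fppf_local_aic (R : comNzRingType) :
  fppf_local R -> absolutely_integrally_closed R.
Proof.
case=> _ Rloc f f_monic f_gt1.
have [r rK] := Rloc _ _ (qpoly_fppf f_monic f_gt1).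
exists (r (in_qpoly f 'X)); apply/rootP.
(* The retraction is R-linear, so it evaluates at the image of X. *)
have r_eval p : r (in_qpoly f p) = p.[r (in_qpoly f 'X)].
  elim/poly_ind: p => [|p c IH]; first by rewrite !rmorph0 horner0.
  rewrite !hornerE !(rmorphD, rmorphM) IH.
  congr (_ + _); rewrite -[RHS]rK; congr (r _); apply/val_inj/in_qpoly_small.
  exact: leq_ltn_trans (size_polyC_leq1 c) (size_mk_monic_gt1 f).
rewrite -r_eval; have -> : in_qpoly f f = 0; last exact: rmorph0.
apply: val_inj; rewrite /= /mk_monic f_gt1 f_monic.
by rewrite -[X in rmodp X]mul1r rmodp_mull.
Qed.

Lemma aic_split (A : comNzRingType) : absolutely_integrally_closed A ->
  forall f : {poly A}, f \is monic ->
    exists rs, f = \prod_(a <- rs) ('X - a%:P).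
Proof.
move=> A_aic f; have [k] := ubnP (size f).
elim: k f => // k IH f f_lt f_monic.
have [f_gt1|f_le1] := ltnP 1 (size f).
  have [a /factor_theorem[q fE]] := A_aic f f_monic f_gt1.
  have q_monic : q \is monic by rewrite -(monicMr q (monicXsubC a)) -fE.
  have [|rs qE] := IH q _ q_monic.
    move: f_lt; rewrite fE size_Mmonic ?monicXsubC ?monic_neq0 //.
    by rewrite size_XsubC addn2.
  by exists (a :: rs); rewrite big_cons -qE mulrC.
exists [::]; rewrite big_nil [LHS](size1_polyC f_le1) -polyC1 -(eqP f_monic).
by rewrite lead_coefE; case: (size f) f_le1 => [|[]].
Qed.

Lemma aic_residue_closed (A : comNzRingType) (m : max_idealr A) :
  absolutely_integrally_closed A -> GRing.closed_field_axiom (residue m).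
Proof.
move=> A_aic n P n_gt0.
have /choice[Q QP] i : exists q, to_residue m q = P i by apply: to_residue_surj.
pose g := \poly_(i < n) Q i; pose f := 'X^n - g.
have g_lt : (size (- g) < size ('X^n : {poly A}))%N.
  by rewrite size_polyXn size_polyN ltnS size_poly.
have f_size : size f = n.+1 by rewrite size_polyDl // size_polyXn.
have f_monic : f \is monic by rewrite monicE lead_coefDl ?lead_coefXn.
have [|a /rootP] := A_aic f f_monic; first by rewrite f_size.
rewrite !hornerE horner_poly => /subr0_eq fa0; exists (to_residue m a).
rewrite -rmorphXn fa0 rmorph_sum /=; apply: eq_bigr => i _.
by rewrite rmorphM rmorphXn /= QP.
Qed.

Lemma closed_separably_closed (K : fieldType) :
  GRing.closed_field_axiom K -> separably_closed K.
Proof.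
move=> K_closed f _ f_gt1; apply/PreClosedField.closed_rootP => //.
by rewrite gtn_eqF.
Qed.

(** Over the residue field, the roots of the reduction of a product of factors
    X - a are the residues of the a, since a field has no zero divisors. *)
Lemma aic_henselian (A : comNzRingType) :
  is_local A -> absolutely_integrally_closed A -> henselian A.
Proof.
move=> A_loc A_aic; split=> // m f x f_monic fx _.
have [rs fE] := aic_split A_aic f_monic.
have {fx} : root (\prod_(b <- map (to_residue m) rs) ('X - b%:P)) x.
  rewrite big_map; move: fx; rewrite fE rmorph_prod.
  by under eq_bigr => a _ do rewrite rmorphB /= map_polyX map_polyC.
rewrite root_prod_XsubC => /mapP[a a_rs ->]; exists a; split=> //.
by rewrite fE /root horner_prod (big_rem a) //= hornerXsubC subrr mul0r.
Qed.

(** Any proper ideal lies in J, as an element outside J is a unit; so J is the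
    largest proper ideal. *)
Lemma is_local_unit_complement (A : comNzRingType) (J : idealr A) :
  (forall x, x \notin J -> exists y, y * x = 1) -> is_local A.
Proof.
move=> J_unit.
have subJ (K : idealr A) : {subset K <= J}.
  move=> x xK; apply/negPn/negP => /J_unit[y yx].
  by have /negP[] := idealr1 K; rewrite -yx idealMr.
pose m : max_idealr A := HB.pack (Idealr.sort J) (Idealr.class J)
  (isMaxIdealr.Build A J (fun K _ => subJ K)).
exists m => m' x; apply/idP/idP; first exact: subJ.
by apply: (max_idealr_subproof (s := m') m); apply: subJ.
Qed.

(** * Localization at a prime *)

Section LocalizationTheory.
Variables (R : comNzRingType) (p : prime_idealr R).

Lemma to_loc_eq (a b : R) :
  to_loc p a = to_loc p b -> exists2 t, t \notin p & t * a = t * b.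
Proof. by move/eqP/loc_piE => /= [t tp]; rewrite !mulr1 => e; exists t. Qed.

Lemma to_loc_unit (s : R) : s \notin p -> exists y, y * to_loc p s = 1.
Proof.
move=> sp; exists (\pi_(loc p) (PreFrac (pnum := (1, s)) sp)).
rewrite [LHS]pi_loc_mul; apply/eqP/loc_piE.
by exists 1; rewrite ?one_notin_prime //= !mulr1.
Qed.

Lemma loc_frac (x : loc p) :
  exists a s, s \notin p /\ to_loc p s * x = to_loc p a.
Proof.
elim/quotW: x => -[[a s] sp]; exists a, s; split=> //.
rewrite [LHS]pi_loc_mul /to_loc; apply/eqP/loc_piE.
by exists 1; rewrite ?one_notin_prime //=; ring.
Qed.

Lemma loc_common_denominator (f : {poly loc p}) :
  exists2 s, s \notin p & forall i, exists a, to_loc p s * f`_i = to_loc p a.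
Proof.
elim/poly_ind: f => [|f c [s sp fE]].
  exists 1; first exact: one_notin_prime.
  by move=> i; exists 0; rewrite coef0 mulr0 rmorph0.
have [b [t [tp cE]]] := loc_frac c.
exists (s * t); first exact: mul_notin_prime.
move=> i; rewrite rmorphM coefD coefMX coefC; case: i => [|i] /=.
  by exists (s * b); rewrite add0r -mulrA cE -rmorphM.
have [a aE] := fE i; exists (t * a).
by rewrite addr0 mulrAC aE -rmorphM mulrC.
Qed.

Lemma loc_is_local : is_local (loc p).
Proof.
pose S : {pred loc p} := fun x =>
  `[< exists a s, [/\ a \in p, s \notin p & to_loc p s * x = to_loc p a] >].
have S_closed : idealr_closed S.
  split.
  - apply/asboolP; exists 0, 1; rewrite rpred0 one_notin_prime; split=> //.
    by rewrite mulr0 rmorph0.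
  - apply/negP=> /asboolP[a [s [ap sp]]]; rewrite mulr1 => /to_loc_eq[t tp e].
    by have /negP[] := mul_notin_prime tp sp; rewrite e idealMr.
  - move=> x u v /asboolP[a [s [ap sp uE]]] /asboolP[b [t [bp tp vE]]].
    have [c [r [rp xE]]] := loc_frac x.
    apply/asboolP; exists (t * (c * a) + r * s * b), (r * s * t); split.
    + by rewrite rpredD // !idealMr.
    + by rewrite !mul_notin_prime.
    + by rewrite rmorphD !rmorphM /= -xE -uE -vE; ring.
pose J : idealr (loc p) :=
  HB.pack (S : loc p -> bool) (isIdealr.Build _ _ S_closed).
apply: (@is_local_unit_complement _ J) => x xJ.
have [a [s [sp xE]]] := loc_frac x.
have ap : a \notin p.
  by apply: contraNN xJ => ap; apply/asboolP; exists a, s.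
have [y ya] := to_loc_unit ap; exists (y * to_loc p s).
by rewrite -mulrA xE.
Qed.

Lemma aic_loc :
  absolutely_integrally_closed R -> absolutely_integrally_closed (loc p).
Proof.
move=> R_aic f f_monic f_gt1.
have [s sp /choice[a aE]] := loc_common_denominator f.
pose n := (size f).-1.
have n_gt0 : (0 < n)%N by rewrite -ltnS prednK // ltnW.
(* 'X^n + g is s^n f(Y/s): its coefficient s^(n-i) f_i is the image of
   a_i s^(n-1-i), as a_i is the numerator of f_i over s. *)
pose g := \poly_(i < n) (a i * s ^+ (n.-1 - i)).
have g_lt : (size g < size ('X^n : {poly R}))%N.
  by rewrite size_polyXn ltnS size_poly.
have h_monic : 'X^n + g \is monic by rewrite monicE lead_coefDl ?lead_coefXn.
have [|c /rootP] := R_aic _ h_monic.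
  by rewrite size_polyDl // size_polyXn.
have [u us] := to_loc_unit sp.
rewrite hornerD hornerXn horner_poly => /(congr1 (to_loc p)).
rewrite rmorph0 rmorphD rmorphXn rmorph_sum /= => c0.
exists (u * to_loc p c); apply/rootP.
have sK : to_loc p s * (u * to_loc p c) = to_loc p c.
  by rewrite mulrA [_ * u]mulrC us mul1r.
move: (u * to_loc p c) sK => y sK.
suff sf0 : to_loc p s ^+ n * f.[y] = 0.
  by rewrite -[f.[y]]mul1r -(expr1n _ n) -us exprMn -mulrA sf0 mulr0.
rewrite -{}c0 horner_coef -(prednK (ltnW f_gt1)) -/n big_ord_recr /=.
have -> : f`_n = 1 by apply/eqP.
rewrite mul1r mulrDr addrC -exprMn sK; congr (_ + _).
rewrite mulr_sumr; apply: eq_bigr => i _.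
rewrite !rmorphM !rmorphXn /= -aE -sK exprMn.
have -> : to_loc p s ^+ n
  = to_loc p s * to_loc p s ^+ (n.-1 - i) * to_loc p s ^+ i.
  by rewrite -exprS -exprD addSn subnK ?prednK // -ltnS prednK.
by ring.
Qed.

End LocalizationTheory.

Theorem theorem4p6 (R : comNzRingType) (hR : fppf_local R) (p : prime_idealr R) :
  strictly_local (loc p) /\
  forall m : max_idealr (loc p), GRing.closed_field_axiom (residue m).
Proof.
have Rp_aic := aic_loc (p := p) (fppf_local_aic hR).
have residue_closed m := @aic_residue_closed _ m Rp_aic.
split=> //; split; first exact: aic_henselian (loc_is_local p) Rp_aic.
by move=> m; apply/closed_separably_closed/residue_closed.
Qed.
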